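(* Suppose $c\geq a>0$ and $\{g_n\}_{n=0}^{\infty}$ is any nonnegative sequence. Let $$g_{a,c}(\mu;x)=\sum_{n=0}^{\infty}g_n\frac{\Gamma(a+n+\mu)}{\Gamma(c+n+\mu)}\frac{x^n}{n!},\qquad \psi_{a,c}(\mu,\nu;x)=g_{a,c}(\mu;x)g_{a,c}(\nu;x)-g_{a,c}(0;x)g_{a,c}(\mu+\nu;x).$$ Then the function $\mu\mapsto g_{a,c}(\mu;x)$ is Wright log-convex on $[0,\infty)$ for each fixed $x\geq0$. Moreover, the family $\{g_{a,c}(\mu;x)\}_{\mu\geq0}$ is Wright $q$-log-convex, i.e. $\psi_{a,c}(\mu,\nu;x)$ has non-positive power series coefficients (in powers of $x$) for all $\mu,\nu\geq0$, so that $x\mapsto-\psi_{a,c}(\mu,\nu;x)$ is absolutely monotonic and multiplicatively convex on $(0,\infty)$.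
   Context: A function $F:[0,\infty)\to[0,\infty)$ is Wright log-convex if $F(\mu+\alpha)F(\mu+\beta)\le F(\mu)F(\mu+\alpha+\beta)$ for all $\mu,\alpha,\beta\ge0$. A family $\{f(\mu;x)\}_{\mu\ge0}$ of formal power series in $x$ whose coefficients are nonnegative continuous functions of $\mu$ is Wright $q$-log-convex if $f(\mu+\alpha;x)f(\mu+\beta;x)-f(\mu;x)f(\mu+\alpha+\beta;x)$ has non-positive coefficients at all powers of $x$ for all $\mu,\alpha,\beta\ge0$. A function is absolutely monotonic on an interval if it and all its derivatives are nonnegative there. A nonnegative function $\phi$ is multiplicatively convex if $\phi(x^{\lambda}y^{1-\lambda})\le\phi(x)^{\lambda}\phi(y)^{1-\lambda}$ for all $x,y$ in the interval and $\lambda\in[0,1]$. Power series are understood as formal; assertions about values at fixed $x$, or about functions of $x$ on $(0,\infty)$, are understood for those $x$ in the interval of convergence of the series. *)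

(* Defs.v *)
From mathcomp Require Import all_boot all_order all_algebra.
From mathcomp Require Import all_classical all_reals all_analysis.
Import Order.TTheory GRing.Theory Num.Theory.
Import numFieldNormedType.Exports.

Set Implicit Arguments.
Unset Strict Implicit.
Unset Printing Implicit Defensive.

Local Open Scope classical_set_scope.
Local Open Scope ring_scope.

(* Euler's integral; meaningful for s > 0, the only range used below. *)
Definition Gamma (R : realType) (s : R) : R :=
  \int[@lebesgue_measure R]_(t in `]0, +oo[) (t `^ (s - 1) * expR (- t)).

(* A formal power series is its sequence of coefficients [nat -> R]. *)
Definition cauchy_prod (R : realType) (f h : nat -> R) : nat -> R :=
  fun n => \sum_(i < n.+1) f i * h (n - i)%N.

Definition ps_domain (R : realType) (f : nat -> R) : set R :=
  [set x | cvgn (pseries f x)].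

Definition ps_eval (R : realType) (f : nat -> R) (x : R) : R :=
  limn (pseries f x).

(* Only the values of [F] on [0, +oo[ matter. *)
Definition wright_log_convex (R : realType) (F : R -> R) : Prop :=
  (forall mu : R, 0 <= mu -> 0 <= F mu) /\
  (forall mu alpha beta : R, 0 <= mu -> 0 <= alpha -> 0 <= beta ->
     F (mu + alpha) * F (mu + beta) <= F mu * F (mu + alpha + beta)).

(* [f mu n] is the coefficient of x^n in f(mu; x). *)
Definition wright_q_log_convex (R : realType) (f : R -> nat -> R) : Prop :=
  [/\ forall (mu : R) n, 0 <= mu -> 0 <= f mu n,
      forall n, {within `[0, +oo[, continuous (fun mu : R => f mu n)} &
      forall mu alpha beta : R, 0 <= mu -> 0 <= alpha -> 0 <= beta -> forall n,
        cauchy_prod (f (mu + alpha)) (f (mu + beta)) n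
        - cauchy_prod (f mu) (f (mu + alpha + beta)) n <= 0].

(* A power series with nonnegative coefficients may converge at the right end
   of its interval of convergence while its derivatives blow up there, hence
   the derivatives are only considered in the interior. *)
Definition absolutely_monotonic (R : realType) (I : set R) (f : R -> R) : Prop :=
  (forall x, I x -> 0 <= f x) /\
  (forall (n : nat) (x : R), interior I x ->
     derivable (derive1n n f) x 1 /\ 0 <= derive1n n f x).

(* [powR] satisfies 0 `^ 0 = 1, the usual convention when phi vanishes. *)
Definition multiplicatively_convex (R : realType) (I : set R) (phi : R -> R) :
    Prop :=
  (forall x, I x -> 0 <= phi x) /\
  (forall x y lambda : R, I x -> I y -> 0 <= lambda <= 1 ->
     phi (x `^ lambda * y `^ (1 - lambda))
     <= phi x `^ lambda * phi y `^ (1 - lambda)).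

Definition g_coef (R : realType) (g : nat -> R) (a c mu : R) : nat -> R :=
  fun n => g n * (Gamma (a + n%:R + mu) / Gamma (c + n%:R + mu)) / n`!%:R.

Definition g_fun (R : realType) (g : nat -> R) (a c mu x : R) : R :=
  ps_eval (g_coef g a c mu) x.

Definition psi_coef (R : realType) (g : nat -> R) (a c mu nu : R) : nat -> R :=
  fun n => cauchy_prod (g_coef g a c mu) (g_coef g a c nu) n
           - cauchy_prod (g_coef g a c 0) (g_coef g a c (mu + nu)) n.

Definition psi_fun (R : realType) (g : nat -> R) (a c mu nu x : R) : R :=
  g_fun g a c mu x * g_fun g a c nu x - g_fun g a c 0 x * g_fun g a c (mu + nu) x.

(* The points of ]0, +oo[ at which all four series in psi converge. *)
Definition psi_domain (R : realType) (g : nat -> R) (a c mu nu : R) : set R :=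
  `]0, +oo[ `&`
  (ps_domain (g_coef g a c mu) `&` ps_domain (g_coef g a c nu) `&`
   ps_domain (g_coef g a c 0) `&` ps_domain (g_coef g a c (mu + nu))).

(* Main.v *)
Require Import Defs.
From mathcomp Require Import all_boot all_order all_algebra.
From mathcomp Require Import all_classical all_reals all_analysis.
From mathcomp Require Import measurable_realfun ring lra.
Import Order.TTheory GRing.Theory Num.Theory.
Import numFieldNormedType.Exports.
Local Open Scope classical_set_scope.
Local Open Scope ring_scope.

(** Put [F t = Gamma (a + t) / Gamma (c + t)]. The coefficient of [x ^+ n] in
    [g_{a,c}(mu; x)] is a nonnegative weight times [F (n + mu)], and everything
    follows from the Wright log-convexity of [F] on [0, +oo[.

    Log-convexity of [F] ([gamma_ratio_wright]) is the statement that the cross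
    ratio [Gamma (s + p) * Gamma (s + q) / (Gamma s * Gamma (s + p + q))] is
    nondecreasing in [s]. The functional equation writes its value at [s] as its
    value at [s + 1] times [1 - p * q / ((s + p) * (s + q))], which is
    nondecreasing in [s], and the cross ratio tends to 1 along [s + n]; so the
    ratio of the values at two points is an infinite product of factors at most
    1 ([cross_ratio_nondecreasing]). This uses only that [Gamma] is positive,
    log-convex ([Gamma_wright]) and satisfies the functional equation
    ([GammaD1]); these facts are derived from Euler's integral.

    For the convolutions ([cauchy_prod_wright]), the terms of index [k] and
    [n - k] are paired. Calling [u], [v] the two products on the smaller side and
    [r], [s] those on the larger one, log-convexity gives [u <= r], [v <= r] and
    [u * v <= r * s], hence [u + v <= r + s]. So minus psi has nonnegative
    coefficients.

    Since the coefficients are nonnegative, the Cauchy product converges to the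
    product of the sums wherever the series converge ([cvg_cauchy_prod]). This
    turns the coefficientwise inequality into the inequality between values, and
    presents minus psi as the sum of a power series with nonnegative
    coefficients. Such a sum is absolutely monotonic by term by term
    differentiation ([absolutely_monotonic_ps]) and multiplicatively convex by
    Hoelder's inequality ([multiplicatively_convex_ps]). *)

Set Implicit Arguments.
Unset Strict Implicit.
Unset Printing Implicit Defensive.

(** * Euler's integral: finiteness, functional equation and positivity *)

Lemma le_natr (R : realType) (x : R) : exists k : nat, x <= k%:R.
Proof. by exists (Num.truncn x).+1; apply/ltW/Num.Theory.truncnS_gt. Qed.

Definition gamma_kernel (R : realType) (s t : R) : R :=
  t `^ (s - 1) * expR (- t).

Lemma gamma_kernel_ge0 (R : realType) (s t : R) : 0 <= gamma_kernel s t.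
Proof. by rewrite mulr_ge0 ?powR_ge0 ?expR_ge0. Qed.

Lemma gamma_kernel_gt0 (R : realType) (s t : R) : 0 < t -> 0 < gamma_kernel s t.
Proof. by move=> t0; rewrite mulr_gt0 ?powR_gt0 ?expR_gt0. Qed.

Lemma gamma_kernelM (R : realType) (s p t : R) : 0 < t ->
  gamma_kernel (s + p) t = t `^ p * gamma_kernel s t.
Proof.
move=> t0; rewrite /gamma_kernel mulrA -powRD; first by congr (_ `^ _ * _); ring.
by rewrite (gt_eqF t0) implybT.
Qed.

Lemma continuous_gamma_kernel (R : realType) (s t : R) : 0 < t ->
  {for t, continuous (gamma_kernel s)}.
Proof.
move=> t0; apply: continuousM.
  apply: differentiable_continuous; apply/derivable1_diffP.
  by apply: derivable_powR; rewrite in_itv /= t0.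
apply: continuous_comp; first exact: opp_continuous.
exact: continuous_expR.
Qed.

Lemma measurable_gamma_kernel (R : realType) (s : R) :
  measurable_fun (`]0, +oo[ : set R) (gamma_kernel s).
Proof.
apply: open_continuous_measurable_fun; first exact: interval_open.
move=> t; rewrite inE /= in_itv /= andbT; exact: continuous_gamma_kernel.
Qed.

Lemma is_derive_gamma_kernel_next (R : realType) (s t : R) : 0 < t ->
  is_derive t 1 (gamma_kernel (s + 1))
    (s * gamma_kernel s t - gamma_kernel (s + 1) t).
Proof.
move=> t0; rewrite /gamma_kernel addrK.
have dp := is_derive1_powR s t0.
have de : is_derive t 1 (fun u : R => expR (- u)) (- expR (- t)).
  by apply: is_derive_eq; rewrite mulrN1.
apply: is_derive_eq.
rewrite /GRing.scale /=; ring.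
Qed.

Lemma gamma_kernel_segment_integrable (R : realType) (s a b : R) : 0 < a ->
  (@lebesgue_measure R).-integrable `[a, b] (EFin \o gamma_kernel s).
Proof.
move=> a0; apply: continuous_compact_integrable; first exact: segment_compact.
apply: continuous_in_subspaceT => t; rewrite inE /= in_itv /= => /andP[at_ _].
by apply: continuous_gamma_kernel; exact: lt_le_trans at_.
Qed.

(** The truncated form of [Gamma (s + 1) = s * Gamma s]: the derivative of
    [gamma_kernel (s + 1)] is integrated over the segment. At [s = 0] the left
    side vanishes and the integral of [expR (- t)] comes out. *)
Lemma gamma_kernel_segment (R : realType) (s a b : R) : 0 < a -> a < b ->
  s * \int[@lebesgue_measure R]_(t in `[a, b]) gamma_kernel s t =
  \int[@lebesgue_measure R]_(t in `[a, b]) gamma_kernel (s + 1) t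
  + (gamma_kernel (s + 1) b - gamma_kernel (s + 1) a).
Proof.
move=> a0 ab.
have int p := gamma_kernel_segment_integrable p b a0.
have pos t : t \in `[a, b] -> 0 < t.
  by rewrite in_itv /= => /andP[? _]; exact: lt_le_trans a0 _.
rewrite -RintegralZl //.
apply/eqP; rewrite addrC -subr_eq; apply/eqP.
rewrite -RintegralB //; last first.
  rewrite (_ : _ \o _ = (fun x => s%:E * (gamma_kernel s x)%:E)%E); last first.
    by apply/funext => x /=; rewrite EFinM.
  by have := @integrableZl _ _ _ (@lebesgue_measure R) `[a, b]
    (measurable_itv _) s (EFin \o gamma_kernel s) (int s).
rewrite /Rintegral.
rewrite (@continuous_FTC2 _ _ (gamma_kernel (s + 1))) //.
- apply: continuous_in_subspaceT => t; rewrite inE /= => /pos t0.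
  apply: cvgB; last exact: continuous_gamma_kernel.
  by apply: cvgM; [exact: cvg_cst|exact: continuous_gamma_kernel].
- split.
  + move=> t /subset_itv_oo_cc /pos t0.
    by have [] := is_derive_gamma_kernel_next s t0.
  + apply: cvg_at_right_filter; exact: continuous_gamma_kernel.
  + apply: cvg_at_left_filter; apply: continuous_gamma_kernel; exact: lt_trans ab.
- move=> t /subset_itv_oo_cc /pos t0; rewrite derive1E.
  by have [_ ->] := is_derive_gamma_kernel_next s t0.
Qed.

(** The bounds are shifted so that every segment, the first one included, is
    nondegenerate and stays away from the singularity of the kernel at 0. *)
Definition exhaust (R : realType) (n : nat) : set R := `[n.+1%:R^-1, n.+2%:R].
Arguments exhaust : clear implicits.

Lemma nondecreasing_exhaust (R : realType) : nondecreasing_seq (exhaust R).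
Proof.
move=> m n mn; apply/subsetPset => t; rewrite /exhaust /= !in_itv /= => /andP[mt tm].
apply/andP; split.
  by apply: le_trans mt; rewrite lef_pV2 ?posrE // ler_nat.
by apply: le_trans tm _; rewrite ler_nat.
Qed.

Lemma bigcup_exhaust (R : realType) : \bigcup_n exhaust R n = `]0, +oo[%classic.
Proof.
apply/seteqP; split=> t.
  move=> [n _]; rewrite /exhaust /= !in_itv /= andbT => /andP[nt _].
  by apply: lt_le_trans nt; rewrite invr_gt0.
rewrite /= in_itv /= andbT => t0.
have [m tm] := le_natr t.
have [k tk] := le_natr (t^-1).
exists (m + k)%N => //; rewrite /exhaust /= in_itv /=; apply/andP; split.
  rewrite invf_ple ?posrE //.
  by apply: le_trans tk _; rewrite ler_nat; apply: leq_trans (leq_addl m k) _.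
by apply: le_trans tm _; rewrite ler_nat -!addnS leq_addr.
Qed.

Lemma cvg_exhaust_integral (R : realType) (f : R -> R) :
  measurable_fun (`]0, +oo[ : set R) f -> (forall t, 0 <= f t) ->
  (\int[@lebesgue_measure R]_(t in exhaust R n) (f t)%:E)%E @[n --> \oo] -->
  (\int[@lebesgue_measure R]_(t in `]0%R, +oo[) (f t)%:E)%E.
Proof.
move=> mf f0; rewrite -bigcup_exhaust.
apply: (@ge0_nondecreasing_set_cvg_integral _ (measurableTypeR R) R
  (exhaust R) (EFin \o f) lebesgue_measure).
- exact: nondecreasing_exhaust.
- by move=> i; exact: measurable_itv.
- move=> i; apply/measurable_EFinP; apply: measurable_funS mf => //.
  by rewrite -bigcup_exhaust; exact: bigcup_sup.
- by move=> i x _ /=; rewrite lee_fin.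
Qed.

Lemma exhaust_Rintegral (R : realType) (s : R) (n : nat) :
  (\int[@lebesgue_measure R]_(t in exhaust R n) (gamma_kernel s t)%:E)%E =
  (\int[@lebesgue_measure R]_(t in exhaust R n) gamma_kernel s t)%:E.
Proof.
rewrite /Rintegral fineK //; apply: integrable_fin_num; first exact: measurable_itv.
by apply: gamma_kernel_segment_integrable; rewrite invr_gt0.
Qed.

Lemma exhaust_lt (R : realType) (n : nat) : n.+1%:R^-1 < n.+2%:R :> R.
Proof.
by apply: (@le_lt_trans _ _ 1); [rewrite invf_le1 ?ler1n|rewrite ltr1n].
Qed.

Lemma gamma_kernel_cvg_at0 (R : realType) (s : R) : 0 < s ->
  gamma_kernel (s + 1) (n.+1%:R^-1) @[n --> \oo] --> (0 : R).
Proof.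
move=> s0; apply: (@squeeze_cvgr _ _ _ _ (fun=> 0)
  (fun n : nat => (n.+1%:R^-1 : R) `^ s)).
- near=> n; rewrite gamma_kernel_ge0 /= /gamma_kernel addrK ler_piMr ?powR_ge0 //.
- exact: cvg_cst.
- have := @powR_cvg0 R s s0 => /cvg_at_rightP; apply; split.
    by move=> n; rewrite invr_gt0.
  exact: cvg_harmonic.
Unshelve. all: by end_near. Qed.

(** For [s <= k], one term of the exponential series already beats the power:
    [expR t >= t ^+ k.+1 / k.+1`!]. *)
Lemma gamma_kernel_cvg_at_infty (R : realType) (s : R) :
  gamma_kernel (s + 1) (n.+2%:R) @[n --> \oo] --> (0 : R).
Proof.
have [k sk] := le_natr s.
apply: (@squeeze_cvgr _ _ _ _ (fun=> 0) (fun n : nat => k.+1`!%:R * n.+1%:R^-1)).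
- near=> n; rewrite gamma_kernel_ge0 /= /gamma_kernel addrK.
  rewrite expRN ler_pdivrMr ?expR_gt0 //.
  apply: (@le_trans _ _ (n.+2%:R ^+ k)).
    by rewrite -powR_mulrn //; apply: ler_powR => //; rewrite ler1n.
  have h := @expR_ge1Dxn R n.+2%:R k (ler0n _ _).
  apply: (@le_trans _ _ (k.+1`!%:R / n.+1%:R *
    (n.+2%:R ^+ k.+1 / k.+1`!%:R))); last first.
    by rewrite ler_wpM2l // ?mulr_ge0 ?invr_ge0 //; apply: le_trans h; rewrite lerDr.
  have k0 : k.+1`!%:R != 0 :> R by rewrite pnatr_eq0 -lt0n fact_gt0.
  rewrite (_ : _ * _ = n.+2%:R ^+ k * (n.+2%:R / n.+1%:R)); last first.
    have n0 : n.+1%:R != 0 :> R by rewrite pnatr_eq0.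
    by rewrite exprS; field; rewrite nat1r n0 k0.
  by rewrite ler_peMr ?exprn_ge0 // ler_pdivlMr // mul1r ler_nat.
- exact: cvg_cst.
- rewrite -(mulr0 (k.+1`!%:R)); apply: cvgMr; exact: cvg_harmonic.
Unshelve. all: by end_near. Qed.

(** Extended real valued, so that the functional equation can be proved
    before anything is known to be finite; finiteness is then deduced from it. *)
Definition gamma_integral (R : realType) (s : R) : \bar R :=
  (\int[@lebesgue_measure R]_(t in `]0%R, +oo[) (gamma_kernel s t)%:E)%E.

(** Both sides are limits of integrals over the exhausting segments, where the
    identity holds up to boundary terms that tend to 0. Since it holds also
    when both sides are infinite, it transfers finiteness from [s + 1] to [s]. *)
Lemma gamma_integral_succ (R : realType) (s : R) : 0 < s ->
  (s%:E * gamma_integral s = gamma_integral (s + 1))%E.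
Proof.
move=> s0.
have cv (p : R) :=
  cvg_exhaust_integral (measurable_gamma_kernel p) (gamma_kernel_ge0 p).
have l := cvgeZl (y := s%:E) isT (cv s).
pose r n : R := gamma_kernel (s + 1) n.+2%:R - gamma_kernel (s + 1) n.+1%:R^-1.
have r0 : r n @[n --> \oo] --> (0 : R).
  rewrite -[X in _ --> X](subrr 0); apply: cvgB.
    exact: gamma_kernel_cvg_at_infty.
  exact: gamma_kernel_cvg_at0.
have l' : (\int[@lebesgue_measure R]_(t in exhaust R n) (gamma_kernel (s + 1) t)%:E
          + (r n)%:E)%E @[n --> \oo] --> (gamma_integral (s + 1) + 0%:E)%E.
  apply: cvgeD; first exact: fin_num_adde_defl.
    exact: cv.
  by apply: cvg_EFin; [exact: nearW|exact: r0].
rewrite -[RHS]adde0.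
apply: cvg_unique l _; first exact: ereal_hausdorff.
apply: cvg_trans l'; apply: near_eq_cvg; apply: nearW => n /=.
rewrite !exhaust_Rintegral -EFinM gamma_kernel_segment ?exhaust_lt ?invr_gt0 //.
Qed.

Lemma gamma_kernel_integrableP (R : realType) (s : R) :
  (@lebesgue_measure R).-integrable `]0, +oo[ (EFin \o gamma_kernel s) <->
  (gamma_integral s < +oo)%E.
Proof.
have e : (\int[@lebesgue_measure R]_(t in `]0%R, +oo[) `|(EFin \o gamma_kernel s) t|
   = gamma_integral s)%E.
  by apply: eq_integral => t _ /=; rewrite ger0_norm // gamma_kernel_ge0.
split=> [/integrableP[_]|h]; first by rewrite e.
apply/integrableP; split; last by rewrite e.
by apply/measurable_EFinP; exact: measurable_gamma_kernel.
Qed.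

Lemma gamma_integral1_lty (R : realType) : (gamma_integral (1 : R) < +oo)%E.
Proof.
suff : (gamma_integral (1 : R) <= 1%:E)%E by move=> h; exact: le_lt_trans h (ltry _).
apply: (cvge_to_le (cvg_exhaust_integral (measurable_gamma_kernel (1 : R))
  (gamma_kernel_ge0 1))).
apply: nearW => n; rewrite exhaust_Rintegral lee_fin.
have := @gamma_kernel_segment R 0 _ _ _ (exhaust_lt R n).
rewrite invr_gt0 ltr0n mul0r add0r => /(_ isT).
have h1 := gamma_kernel_ge0 (1 : R) n.+2%:R.
have h2 : gamma_kernel (1 : R) n.+1%:R^-1 <= 1.
  by rewrite /gamma_kernel subrr powRr0 mul1r.
rewrite /exhaust; lra.
Qed.

Lemma gamma_kernel_le (R : realType) (p s q t : R) : 0 < t -> p <= s <= q ->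
  gamma_kernel s t <= gamma_kernel p t + gamma_kernel q t.
Proof.
move=> t0 /andP[ps sq]; rewrite /gamma_kernel -mulrDl ler_pM2r ?expR_gt0 //.
have [t1|/ltW t1] := leP t 1.
  apply: (@le_trans _ _ (t `^ (p - 1))); last by rewrite lerDl powR_ge0.
  by apply: ger_powR; [rewrite t0|rewrite lerB].
apply: (@le_trans _ _ (t `^ (q - 1))); last by rewrite lerDr powR_ge0.
by apply: ler_powR => //; rewrite lerB.
Qed.

(** [gamma_integral 1] is at most 1, the functional equation gives all positive
    integers, domination by two integer exponents gives every [s + 1], and the
    functional equation read backwards gives [s] itself, including the
    exponents below 1 where the kernel is unbounded. *)
Lemma gamma_kernel_integrable (R : realType) (s : R) : 0 < s ->
  (@lebesgue_measure R).-integrable `]0, +oo[ (EFin \o gamma_kernel s).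
Proof.
have nat_case k : (gamma_integral (k.+1%:R : R) < +oo)%E.
  elim: k => [|k IH]; first exact: gamma_integral1_lty.
  rewrite -(natr1 k.+1) -gamma_integral_succ // lte_mul_pinfty //.
move=> s0.
have [k sk] := le_natr s.
have : (@lebesgue_measure R).-integrable `]0, +oo[ (EFin \o gamma_kernel (s + 1)).
  have i1 := (gamma_kernel_integrableP (1 : R)).2 (nat_case 0%N).
  have ik := (gamma_kernel_integrableP (k.+1%:R : R)).2 (nat_case k).
  apply: le_integrable (integrableD _ i1 ik) => //=.
    by apply/measurable_EFinP; exact: measurable_gamma_kernel.
  move=> t; rewrite /= in_itv /= andbT => t0.
  rewrite lee_fin !ger0_norm ?addr_ge0 ?gamma_kernel_ge0 //.
  by apply: gamma_kernel_le => //; rewrite lerDr ltW //= -natr1 lerD2r.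
move/gamma_kernel_integrableP; rewrite -gamma_integral_succ // => h.
apply/gamma_kernel_integrableP; rewrite ltey; apply/eqP => E; move: h.
by rewrite E gt0_muley ?lte_fin // ltxx.
Qed.

Lemma GammaD1 (R : realType) (s : R) : 0 < s -> Gamma (s + 1) = s * Gamma s.
Proof.
have fin (p : R) : 0 < p -> gamma_integral p \is a fin_num.
  by move=> p0; apply: integrable_fin_num (gamma_kernel_integrable p0).
move=> s0; have := gamma_integral_succ s0.
by rewrite -(fineK (fin _ s0)) -(fineK (fin (s + 1) _)) ?addr_gt0 // -EFinM => -[/esym].
Qed.

Lemma GammaE (R : realType) (s : R) :
  Gamma s = \int[@lebesgue_measure R]_(t in `]0, +oo[) gamma_kernel s t.
Proof. by []. Qed.

(** The kernel is bounded below on the segment [1, 2] by its positive minimum. *)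
Lemma Gamma_gt0 (R : realType) (s : R) : 0 < s -> 0 < Gamma s.
Proof.
move=> s0.
have pos t : t \in `[1, 2] -> 0 < t :> R.
  by rewrite in_itv /= => /andP[+ _]; exact: lt_le_trans.
have [c c12 cmin] : exists2 c : R, c \in `[1, 2] &
    forall t, t \in `[1, 2] -> gamma_kernel s c <= gamma_kernel s t.
  apply: EVT_min; first by rewrite ler1n.
  apply: continuous_in_subspaceT => t; rewrite inE /= => /pos.
  exact: continuous_gamma_kernel.
apply: lt_le_trans (gamma_kernel_gt0 s (pos _ c12)) _.
rewrite -lee_fin GammaE /Rintegral fineK; last first.
  by apply: integrable_fin_num (gamma_kernel_integrable s0).
apply: (@le_trans _ _
    (\int[@lebesgue_measure R]_(t in `[1%R, 2%R]) (gamma_kernel s t)%:E)%E).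
  apply: (@le_trans _ _
      (\int[@lebesgue_measure R]_(t in `[1%R, 2%R]) (cst (gamma_kernel s c)%:E t))%E).
    rewrite integral_cst //= lebesgue_measure_itv /= lte_fin ltr1n /=.
    by rewrite -EFinD -EFinM lee_fin (_ : 2 - 1 = 1) ?mulr1 //; lra.
  apply: ge0_le_integral => //=.
  - by move=> t _; rewrite lee_fin gamma_kernel_ge0.
  - apply/measurable_EFinP; apply: measurable_funS (measurable_gamma_kernel s) => //.
    by move=> t /pos; rewrite /= in_itv /= andbT.
apply: ge0_subset_integral => //=.
- by apply/measurable_EFinP; exact: measurable_gamma_kernel.
- by move=> t _; rewrite lee_fin gamma_kernel_ge0.
- by move=> t /pos; rewrite /= in_itv /= andbT.
Qed.

(** * Log-convexity and continuity of the Gamma function *)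

Lemma gamma_kernel_lin_integrable (R : realType) (x y p q : R) : 0 < p -> 0 < q ->
  (@lebesgue_measure R).-integrable `]0, +oo[
    (EFin \o (fun t => x * gamma_kernel p t + y * gamma_kernel q t)).
Proof.
move=> p0 q0.
have ip := gamma_kernel_integrable p0; have iq := gamma_kernel_integrable q0.
by have := integrableD _ (integrableZl _ x ip) (integrableZl _ y iq); apply.
Qed.

Lemma Gamma_lin (R : realType) (x y p q : R) : 0 < p -> 0 < q ->
  \int[@lebesgue_measure R]_(t in `]0, +oo[)
     (x * gamma_kernel p t + y * gamma_kernel q t) = x * Gamma p + y * Gamma q.
Proof.
move=> p0 q0; rewrite !GammaE.
have ip := gamma_kernel_integrable p0; have iq := gamma_kernel_integrable q0.
rewrite RintegralD //.
- by rewrite !RintegralZl.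
- by have := integrableZl _ x ip; apply.
- by have := integrableZl _ y iq; apply.
Qed.

(** Chebyshev's association argument. Let [m] be the mean of [t `^ p] under the
    weight [gamma_kernel s], that is [Gamma (s + p) / Gamma s], and choose [t0]
    with [t0 `^ p = m]. Both powers being increasing, the product
    [(t `^ p - m) * (t `^ q - t0 `^ q)] is nonnegative for all [t]; integrated
    against the weight it is [Gamma (s + p + q) - m * Gamma (s + q)], because the
    choice of [m] cancels the other two terms. *)
Lemma Gamma_wright (R : realType) (s p q : R) : 0 < s -> 0 <= p -> 0 <= q ->
  Gamma (s + p) * Gamma (s + q) <= Gamma s * Gamma (s + p + q).
Proof.
move=> s0; rewrite le_eqVlt => /predU1P[<- _|p0 q0]; first by rewrite addr0.
have sp : 0 < s + p by rewrite addr_gt0.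
have sq : 0 < s + q by rewrite ltr_pwDl.
have spq : 0 < s + p + q by rewrite ltr_pwDl.
(* The integrated product inequality for an arbitrary [m] in place of the mean;
   [b] is [t0 `^ q]. *)
have key (m : R) : 0 < m -> exists b,
    m * Gamma (s + q) + b * Gamma (s + p) <=
    1 * Gamma (s + p + q) + (m * b) * Gamma s.
  move=> m0; pose t0 := m `^ p^-1; have t00 : 0 < t0 by rewrite powR_gt0.
  have t0p : t0 `^ p = m by rewrite /t0 -powRrM mulVf ?gt_eqF // powRr1 // ltW.
  exists (t0 `^ q).
  rewrite -(Gamma_lin _ _ sq sp) -(Gamma_lin _ _ spq s0).
  apply: le_Rintegral; first exact: measurable_itv.
  - exact: gamma_kernel_lin_integrable.
  - exact: gamma_kernel_lin_integrable.
  move=> t; rewrite /= in_itv /= andbT => t_gt0.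
  rewrite -(addrA s) !gamma_kernelM // powRD ?(gt_eqF t_gt0) ?implybT //.
  rewrite mul1r -subr_ge0.
  rewrite (_ : _ - _ =
    (t `^ p - m) * (t `^ q - t0 `^ q) * gamma_kernel s t); last by ring.
  apply: mulr_ge0; last exact: gamma_kernel_ge0.
  rewrite -t0p.
  have [h|/ltW h] := leP t t0.
    by rewrite mulr_le0 // subr_le0 ge0_ler_powR ?nnegrE // ltW.
  by rewrite mulr_ge0 // subr_ge0 ge0_ler_powR ?nnegrE // ltW.
move: key (Gamma_gt0 s0) (Gamma_gt0 sp).
move: (Gamma s) (Gamma (s + p)) (Gamma (s + q)) (Gamma (s + p + q)).
move=> A B C D key A0 B0.
have [b] := key (B / A) (divr_gt0 B0 A0).
have -> : B / A * b * A = b * B by field; rewrite gt_eqF.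
by rewrite lerD2r mul1r mulrAC ler_pdivrMr // [D * A]mulrC.
Qed.

(** Continuity under the integral: on a neighbourhood of [s] the kernel is
    dominated by the sum of the kernels at its two end points. *)
Lemma continuous_Gamma (R : realType) (s : R) : 0 < s -> {for s, continuous (@Gamma R)}.
Proof.
move=> s0.
have s20 : 0 < s / 2 by rewrite divr_gt0.
have s10 : 0 < s + 1 by rewrite addr_gt0.
have := @continuity_under_integral R _ (measurableTypeR R) lebesgue_measure
  (@gamma_kernel R) `]0, +oo[ (measurable_itv _) (s / 2) (s + 1) _ _
  (fun t => gamma_kernel (s / 2) t + gamma_kernel (s + 1) t).
apply.
- move=> x; rewrite /= in_itv /= => /andP[sx _].
  by apply: gamma_kernel_integrable; exact: lt_trans sx.
- apply: aeW => t; rewrite /= in_itv /= andbT => t0 x _.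
  rewrite (_ : _ ^~ _ = fun l => expR ((l - 1) * ln t) * expR (- t)); last first.
    by apply/funext => l; rewrite /gamma_kernel /powR gt_eqF.
  apply: cvgM; last exact: cvg_cst.
  apply: continuous_comp; last exact: continuous_expR.
  by apply: cvgM; [apply: cvgB; [exact: cvg_id|exact: cvg_cst]|exact: cvg_cst].
- have := gamma_kernel_lin_integrable 1 1 s20 s10; congr (_.-integrable _ _).
  by apply/funext => t /=; rewrite !mul1r.
- move=> x; rewrite /= in_itv /= => /andP[/ltW sx /ltW xs].
  apply: aeW => t; rewrite /= in_itv /= andbT => t0.
  by rewrite ger0_norm ?gamma_kernel_ge0 // gamma_kernel_le // sx xs.
- by rewrite inE /= in_itv /=; apply/andP; split; lra.
Qed.

(** * Monotonicity of the cross ratio *)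

Section CrossRatio.
Variables (R : realType) (G : R -> R).
Hypotheses (G_gt0 : forall s : R, 0 < s -> 0 < G s)
  (G_succ : forall s : R, 0 < s -> G (s + 1) = s * G s)
  (G_wright : forall s p q : R, 0 < s -> 0 <= p -> 0 <= q ->
     G (s + p) * G (s + q) <= G s * G (s + p + q)).

Definition cross_ratio (p q x : R) : R :=
  G (x + p) * G (x + q) / (G x * G (x + p + q)).

Variables p q : R.
Hypotheses (p0 : 0 <= p) (q0 : 0 <= q).

Lemma cross_ratio_gt0 (x : R) : 0 < x -> 0 < cross_ratio p q x.
Proof.
move=> x0; have h (r : R) : 0 <= r -> 0 < G (x + r).
  by move=> r0; apply: G_gt0; rewrite ltr_pwDl.
by rewrite divr_gt0 ?mulr_gt0 // -?addrA ?h ?addr_ge0 // G_gt0.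
Qed.

Lemma cross_ratio_le1 (x : R) : 0 < x -> cross_ratio p q x <= 1.
Proof.
move=> x0; rewrite ler_pdivrMr ?mul1r; first exact: G_wright.
by rewrite mulr_gt0 // G_gt0 // -addrA ltr_pwDl // addr_ge0.
Qed.

(** The factor by which the functional equation relates [cross_ratio] at [x] and
    at [x + 1]. *)
Definition cross_factor (x : R) : R := x * (x + p + q) / ((x + p) * (x + q)).

Lemma cross_factor_ge0 (x : R) : 0 < x -> 0 <= cross_factor x.
Proof. by move=> x0; rewrite divr_ge0 // mulr_ge0 // ?addr_ge0 // ltW. Qed.

(** The factor is [1 - p * q / ((x + p) * (x + q))]. *)
Lemma cross_factor_le (x y : R) : 0 < x -> x <= y -> cross_factor x <= cross_factor y.
Proof.
move=> x0 xy; have y0 : 0 < y by exact: lt_le_trans xy.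
have E (z : R) : 0 < z -> cross_factor z = 1 - p * q / ((z + p) * (z + q)).
  move=> z0; rewrite /cross_factor; field.
  by rewrite !gt_eqF ?ltr_pwDl.
have pos (z r : R) : 0 < z -> 0 <= r -> 0 < z + r by move=> ? ?; rewrite ltr_pwDl.
rewrite !E // lerD2l lerN2 ler_wpM2l ?mulr_ge0 // lef_pV2 ?posrE ?mulr_gt0 ?pos //.
by apply: ler_pM; rewrite ?lerD2r //; apply/ltW/pos.
Qed.

Lemma cross_ratio_succ (x : R) : 0 < x ->
  cross_ratio p q x = cross_factor x * cross_ratio p q (x + 1).
Proof.
move=> x0; rewrite /cross_ratio /cross_factor.
have x1 : 0 < x + p by rewrite ltr_pwDl.
have x2 : 0 < x + q by rewrite ltr_pwDl.
have x3 : 0 < x + p + q by rewrite ltr_pwDl.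
rewrite (_ : x + 1 + p = x + p + 1); last ring.
rewrite (_ : x + 1 + q = x + q + 1); last ring.
rewrite (_ : x + p + 1 + q = x + p + q + 1); last ring.
rewrite !G_succ //.
have := G_gt0 x0; have := G_gt0 x1; have := G_gt0 x2; have := G_gt0 x3.
move: (G x) (G (x + p)) (G (x + q)) (G (x + p + q)) => A B C D D0 C0 B0 A0.
by field; rewrite !gt_eqF.
Qed.

(** By [cross_ratio_succ], a shift by 1 multiplies the quotient of the cross
    ratios at [x] and [y] by a quotient of factors, which is at most 1. *)
Lemma cross_ratio_shift_le (n : nat) (x y : R) : 0 < x -> x <= y ->
  cross_ratio p q x * cross_ratio p q (y + n%:R) <=
  cross_ratio p q y * cross_ratio p q (x + n%:R).
Proof.
elim: n x y => [|n IH] x y x0 xy; first by rewrite !addr0 mulrC.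
have y0 : 0 < y by exact: lt_le_trans xy.
rewrite (cross_ratio_succ x0) (cross_ratio_succ y0).
rewrite -nat1r !addrA -[leLHS]mulrA -[leRHS]mulrA.
have x10 : 0 < x + 1 by rewrite addr_gt0.
have y10 : 0 < y + 1 by rewrite addr_gt0.
apply: ler_pM; rewrite ?cross_factor_ge0 ?cross_factor_le //.
  by rewrite mulr_ge0 // ltW // cross_ratio_gt0 // ltr_pwDl.
by apply: IH => //; rewrite lerD2r.
Qed.

(** Each unit step multiplies the ratio of the two sides by
    [(x + p + j) / (x + j)], which is at most [1 + p / x]. *)
Lemma shift_ratio_le (N : nat) (x : R) : 0 < x ->
  G x * G (x + p + N%:R) <= (1 + p / x) ^+ N * (G (x + p) * G (x + N%:R)).
Proof.
move=> x0; have xp : 0 < x + p by rewrite ltr_pwDl.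
elim: N => [|N IH]; first by rewrite !addr0 expr0 mul1r mulrC.
rewrite -natr1 !addrA !G_succ ?ltr_pwDl // exprSr.
have xN : 0 < x + N%:R by rewrite ltr_pwDl.
rewrite (_ : G x * _ = (x + p + N%:R) * (G x * G (x + p + N%:R))); last ring.
rewrite [leRHS](_ : _ = (1 + p / x) * (x + N%:R) *
   ((1 + p / x) ^+ N * (G (x + p) * G (x + N%:R)))); last by ring.
apply: ler_pM => //.
- by rewrite addr_ge0 // ltW.
- by rewrite mulr_ge0 // ltW // G_gt0 // ltr_pwDl.
rewrite mulrDl mul1r mulrDr -addrA [p + _]addrC addrA lerD2l.
by rewrite divfK ?gt_eqF // lerDl mulr_ge0 ?divr_ge0 // ltW.
Qed.

(** Log-convexity makes [G (x + q) / G (x + q + p)] at least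
    [G (x + N) / G (x + N + p)], so the real shift [q] can be replaced by an
    integer one, to which the functional equation applies. The bound tends to 1
    as [x] grows with [N] fixed. *)
Lemma cross_ratio_ge (N : nat) (x : R) : 0 < x -> q <= N%:R ->
  1 <= (1 + p / x) ^+ N * cross_ratio p q x.
Proof.
move=> x0 qN; have xq : 0 < x + q by rewrite ltr_pwDl.
have Nq : 0 <= N%:R - q by rewrite subr_ge0.
have := G_wright xq p0 Nq.
rewrite (_ : x + q + (N%:R - q) = x + N%:R); last ring.
rewrite (_ : x + q + p + (N%:R - q) = x + p + N%:R); last ring.
rewrite (_ : x + q + p = x + p + q); last ring.
have := shift_ratio_le N x0; rewrite /cross_ratio.
have xp : 0 < x + p by rewrite ltr_pwDl.
have xpq : 0 < x + p + q by rewrite ltr_pwDl.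
have xN : 0 < x + N%:R by rewrite ltr_pwDl.
have xpN : 0 < x + p + N%:R by rewrite ltr_pwDl.
have c0 : 0 < (1 + p / x) ^+ N by rewrite exprn_gt0 // ltr_pwDl // divr_ge0 // ltW.
move: (G_gt0 x0) (G_gt0 xp) (G_gt0 xpq) (G_gt0 xN) (G_gt0 xpN) (G_gt0 xq) c0.
move: (G x) (G (x + p)) (G (x + p + q)) (G (x + N%:R)) (G (x + p + N%:R))
  (G (x + q)) (_ ^+ N).
move=> A B C D E F c A0 B0 C0 D0 E0 F0 c0 h1 h2.
rewrite mulrA ler_pdivlMr ?mulr_gt0 // mul1r.
rewrite -(ler_pM2r (mulr_gt0 D0 E0)).
rewrite [leLHS](_ : _ = (C * D) * (A * E)); last by ring.
rewrite [leRHS](_ : _ = (F * E) * (c * (B * D))); last by ring.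
by apply: ler_pM => //; rewrite mulr_ge0 // ltW.
Qed.

(** Iterating the functional equation reduces the comparison to [x + n] and
    [y + n], and both cross ratios tend to 1 there: they are at most 1, and
    [cross_ratio_ge] bounds the one at [y + n] from below. *)
Lemma cross_ratio_nondecreasing (x y : R) : 0 < x -> x <= y ->
  cross_ratio p q x <= cross_ratio p q y.
Proof.
move=> x0 xy; have y0 : 0 < y by exact: lt_le_trans xy.
have [N qN] := le_natr q.
have B n : cross_ratio p q x <= (1 + p * n.+1%:R^-1) ^+ N * cross_ratio p q y.
  have yn : 0 < y + n.+1%:R by rewrite ltr_pwDl.
  have xn : 0 < x + n.+1%:R by rewrite ltr_pwDl.
  have c0 : 0 <= (1 + p * n.+1%:R^-1) ^+ N by rewrite exprn_ge0 // addr_ge0 // mulr_ge0.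
  have h : 1 <= (1 + p * n.+1%:R^-1) ^+ N * cross_ratio p q (y + n.+1%:R).
    apply: le_trans (cross_ratio_ge yn qN) _.
    apply: ler_wpM2r; first exact/ltW/cross_ratio_gt0.
    have py : 0 <= p / (y + n.+1%:R) by rewrite divr_ge0 // ltW.
    rewrite lerXn2r ?nnegrE ?addr_ge0 // ?mulr_ge0 // lerD2l ler_wpM2l //.
    by rewrite lef_pV2 ?posrE // lerDr ltW.
  apply: (@le_trans _ _ ((1 + p * n.+1%:R^-1) ^+ N *
    (cross_ratio p q x * cross_ratio p q (y + n.+1%:R)))).
    by rewrite mulrCA ler_peMr // ltW // cross_ratio_gt0.
  rewrite ler_wpM2l //; apply: le_trans (cross_ratio_shift_le n.+1 x0 xy) _.
  by rewrite ler_piMr ?cross_ratio_le1 // ltW // cross_ratio_gt0.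
have l : (1 + p * n.+1%:R^-1) ^+ N * cross_ratio p q y @[n --> \oo] -->
    (1 + p * 0) ^+ N * cross_ratio p q y.
  apply: cvgMl; apply: (@cvg_comp _ _ _ _ (fun z : R => z ^+ N)); last first.
    exact: exprn_continuous.
  apply: cvgD; first exact: cvg_cst.
  by apply: cvgMr; exact: cvg_harmonic.
rewrite mulr0 addr0 expr1n mul1r in l.
by apply: ler_cvg_to (cvg_cst _) l _; apply: nearW => n; exact: B.
Qed.

End CrossRatio.

(** * Convolutions of log-convex families *)

(** From [0 <= (r - u) * (r - v)], expanded and divided by [r]. *)
Lemma add_le_of_mul_le (R : realFieldType) (u v r s : R) :
  0 <= u -> 0 <= s -> u <= r -> v <= r -> u * v <= r * s -> u + v <= r + s.
Proof.
move=> u0 s0 ur vr uvrs.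
have [r0|r0] := leP r 0; first by lra.
rewrite -(ler_pM2l r0).
have h : 0 <= (r - u) * (r - v) by rewrite mulr_ge0 // subr_ge0.
nra.
Qed.

(** The symmetrized pair of terms of index [k] and [n - k] in the convolution
    inequality, with [x = k + mu] and [y = n - k + mu]. Taking [x <= y], the first
    product on the right is the extreme one and dominates both products on the
    left, while log-convexity at [x] and at [y] compares the product of the two
    left terms with that of the right ones. No left term need be below
    the second right one, whence [add_le_of_mul_le]. *)
Lemma wright_exchange (R : realType) (F : R -> R) (x y p q : R) :
  wright_log_convex F -> 0 <= x -> 0 <= y -> 0 <= p -> 0 <= q ->
  F (x + p) * F (y + q) + F (y + p) * F (x + q) <=
  F x * F (y + p + q) + F y * F (x + p + q).
Proof.
move=> [F0 Fw].
wlog xy : x y / x <= y.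
  move=> h x0 y0 p0 q0; have [xy|/ltW yx] := leP x y; first exact: h.
  by rewrite addrC [leRHS]addrC h.
move=> x0 y0 p0 q0; pose d := y - x; have d0 : 0 <= d by rewrite subr_ge0.
apply: add_le_of_mul_le.
- by rewrite mulr_ge0 // F0 // addr_ge0.
- by rewrite mulr_ge0 // F0 // !addr_ge0.
- have := Fw x p (d + q) x0 p0 (addr_ge0 d0 q0).
  rewrite (_ : x + (d + q) = y + q); last by rewrite /d; ring.
  by rewrite (_ : x + p + (d + q) = y + p + q) //; rewrite /d; ring.
- have := Fw x (d + p) q x0 (addr_ge0 d0 p0) q0.
  by rewrite (_ : x + (d + p) = y + p) //; rewrite /d; ring.
- rewrite (_ : F (x + p) * _ * _ =
    (F (x + p) * F (x + q)) * (F (y + p) * F (y + q))); last ring.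
  rewrite (_ : F x * _ * _ = (F x * F (x + p + q)) * (F y * F (y + p + q))); last ring.
  by apply: ler_pM; rewrite ?Fw // mulr_ge0 // F0 // addr_ge0.
Qed.

Lemma cauchy_prod_sym2 (R : realType) (f h : nat -> R) (n : nat) :
  cauchy_prod f h n *+ 2 =
  \sum_(i < n.+1) (f i * h (n - i)%N + f (n - i)%N * h i).
Proof.
rewrite mulr2n big_split; congr (_ + _).
rewrite /cauchy_prod (reindex_inj rev_ord_inj) /=; apply: eq_bigr => i _.
by rewrite subSS subKn // -ltnS.
Qed.

(** The weights [v i * v (n - i)] are invariant under [i |-> n - i], so the two
    convolutions may be symmetrized and then compared term by term. *)
Lemma cauchy_prod_wright (R : realType) (F : R -> R) (v : nat -> R)
    (mu p q : R) (n : nat) :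
  wright_log_convex F -> (forall k, 0 <= v k) -> 0 <= mu -> 0 <= p -> 0 <= q ->
  cauchy_prod (fun k => v k * F (k%:R + (mu + p)))
              (fun k => v k * F (k%:R + (mu + q))) n <=
  cauchy_prod (fun k => v k * F (k%:R + mu))
              (fun k => v k * F (k%:R + (mu + p + q))) n.
Proof.
move=> FW v0 mu0 p0 q0.
rewrite -(ler_pMn2r (n := 2)) // !cauchy_prod_sym2; apply: ler_sum => i _.
have k0 (k : nat) : 0 <= k%:R + mu by rewrite addr_ge0.
have h := wright_exchange FW (k0 i) (k0 (n - i)%N) p0 q0.
rewrite -subr_ge0.
rewrite !addrA (_ : _ - _ = v i * v (n - i)%N *
  (F (i%:R + mu) * F ((n - i)%:R + mu + p + q) +
   F ((n - i)%:R + mu) * F (i%:R + mu + p + q) -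
   (F (i%:R + mu + p) * F ((n - i)%:R + mu + q) +
    F ((n - i)%:R + mu + p) * F (i%:R + mu + q)))); last by ring.
by rewrite mulr_ge0 ?subr_ge0 // mulr_ge0.
Qed.

(** * Power series with nonnegative coefficients *)

Lemma cvg_ps_eval (R : realType) (f : nat -> R) (x : R) :
  ps_domain f x -> pseries f x @ \oo --> ps_eval f x.
Proof. by []. Qed.

Lemma pseriesE (R : realType) (f : nat -> R) (x : R) (n : nat) :
  pseries f x n = \sum_(i < n) f i * x ^+ i.
Proof. by rewrite /pseries /series /= big_mkord. Qed.

Lemma pseries_le (R : realType) (f h : nat -> R) (x : R) (n : nat) :
  (forall k, f k <= h k) -> 0 <= x -> pseries f x n <= pseries h x n.
Proof.
move=> fh x0; rewrite !pseriesE; apply: ler_sum => i _.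
by rewrite ler_wpM2r ?exprn_ge0.
Qed.

Lemma pseriesB (R : realType) (f h : nat -> R) (x : R) (n : nat) :
  pseries (fun k => f k - h k) x n = pseries f x n - pseries h x n.
Proof. by rewrite !pseriesE -sumrB; apply: eq_bigr => i _; rewrite mulrBl. Qed.

Lemma pseries_nondecreasing (R : realType) (f : nat -> R) (x : R) :
  (forall n, 0 <= f n) -> 0 <= x -> nondecreasing_seq (pseries f x).
Proof.
by move=> f0 x0; apply: nondecreasing_series => n _ _; rewrite mulr_ge0 ?exprn_ge0.
Qed.

Lemma pseries_le_ps_eval (R : realType) (f : nat -> R) (x : R) (n : nat) :
  (forall n, 0 <= f n) -> 0 <= x -> ps_domain f x -> pseries f x n <= ps_eval f x.
Proof.
by move=> f0 x0 fx; apply: nondecreasing_cvgn_le => //; exact: pseries_nondecreasing.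
Qed.

Lemma ps_eval_ge0 (R : realType) (f : nat -> R) (x : R) :
  (forall n, 0 <= f n) -> 0 <= x -> ps_domain f x -> 0 <= ps_eval f x.
Proof.
move=> f0 x0 fx; apply: le_trans (pseries_le_ps_eval 0%N f0 x0 fx).
by rewrite pseriesE big_ord0.
Qed.

Lemma cauchy_prod_ge0 (R : realType) (f h : nat -> R) (n : nat) :
  (forall n, 0 <= f n) -> (forall n, 0 <= h n) -> 0 <= cauchy_prod f h n.
Proof. by move=> f0 h0; apply: sumr_ge0 => i _; rewrite mulr_ge0. Qed.

(** Partial sums are values of truncated polynomials. The coefficients of the
    product of the truncations agree with the Cauchy product below [N], never
    exceed it, and vanish from [N + N] on. *)
Lemma pseries_cauchy_prod_le (R : realType) (f h : nat -> R) (x : R) (N : nat) :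
  (forall n, 0 <= f n) -> (forall n, 0 <= h n) -> 0 <= x ->
  pseries (cauchy_prod f h) x N <= pseries f x N * pseries h x N
    <= pseries (cauchy_prod f h) x (N + N)%N.
Proof.
move=> f0 h0 x0.
pose P := \poly_(i < N) f i; pose Q := \poly_(i < N) h i.
have sPQ : (size (P * Q)%R <= N + N)%N.
  apply: leq_trans (size_polyMleq _ _) _; apply: leq_trans (leq_pred _) _.
  by apply: leq_add; exact: size_poly.
have -> : pseries f x N * pseries h x N = \sum_(i < N + N) (P * Q)`_i * x ^+ i.
  by rewrite !pseriesE -!horner_poly -hornerM (horner_coef_wide _ sPQ) horner_poly.
have P0 i : 0 <= P`_i by rewrite coef_poly; case: ifP.
have Q0 i : 0 <= Q`_i by rewrite coef_poly; case: ifP.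
rewrite !pseriesE; apply/andP; split.
  rewrite big_split_ord /= -[leLHS]addr0 lerD //; last first.
    apply: sumr_ge0 => i _; rewrite mulr_ge0 ?exprn_ge0 // coefM.
    by apply: sumr_ge0 => j _; rewrite mulr_ge0.
  apply: ler_sum => i _; rewrite le_eqVlt; apply/orP; left; apply/eqP.
  congr (_ * _); rewrite coefM; apply: eq_bigr => j _.
  rewrite !coef_poly (leq_ltn_trans (leq_subr _ _) (ltn_ord i)).
  by rewrite (leq_ltn_trans _ (ltn_ord i)) // -ltnS.
apply: ler_sum => i _; rewrite ler_wpM2r ?exprn_ge0 // coefM.
apply: ler_sum => j _; rewrite !coef_poly.
by case: ifP => _; case: ifP => _; rewrite ?mul0r ?mulr0 ?mulr_ge0.
Qed.

(** For nonnegative terms the sandwich above gives convergence at the end point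
    of the disc as well, where the series may only just converge. *)
Lemma cvg_cauchy_prod (R : realType) (f h : nat -> R) (x : R) :
  (forall n, 0 <= f n) -> (forall n, 0 <= h n) -> 0 <= x ->
  ps_domain f x -> ps_domain h x ->
  pseries (cauchy_prod f h) x @ \oo --> ps_eval f x * ps_eval h x.
Proof.
move=> f0 h0 x0 fx hx.
have c0 n := cauchy_prod_ge0 n f0 h0.
have sq N := pseries_cauchy_prod_le N f0 h0 x0.
have ub N : pseries (cauchy_prod f h) x N <= ps_eval f x * ps_eval h x.
  have /andP[h1 _] := sq N; apply: le_trans h1 _.
  have pos (u : nat -> R) : (forall n, 0 <= u n) -> 0 <= pseries u x N.
    by move=> u0; rewrite pseriesE; apply: sumr_ge0 => i _; rewrite mulr_ge0 ?exprn_ge0.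
  by apply: ler_pM; rewrite ?pos ?pseries_le_ps_eval.
have cx : ps_domain (cauchy_prod f h) x.
  apply: nondecreasing_is_cvgn; first exact: pseries_nondecreasing.
  by exists (ps_eval f x * ps_eval h x) => _ [N _ <-].
suff <- : ps_eval (cauchy_prod f h) x = ps_eval f x * ps_eval h x by [].
apply/eqP; rewrite eq_le; apply/andP; split.
  by apply: limr_le => //; apply: nearW.
have l : pseries f x n * pseries h x n @[n --> \oo] --> ps_eval f x * ps_eval h x.
  exact: cvgM.
rewrite -(cvg_lim _ l) //; apply: limr_le; first exact: cvgP l.
apply: nearW => N /=.
have /andP[_ h2] := sq N; apply: le_trans h2 _.
exact: pseries_le_ps_eval.
Qed.

Lemma ps_domain_le (R : realType) (f : nat -> R) (x z : R) :
  0 <= z -> z <= x -> ps_domain f x -> ps_domain f z.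
Proof.
move=> z0; rewrite le_eqVlt => /predU1P[->//|zx] fx.
by apply: is_cvg_pseries_inside fx _; rewrite !ger0_norm // ltW // (le_lt_trans z0).
Qed.

(** With [d = K / x - 1], Bernoulli's inequality [n * d <= (K / x) ^+ n] bounds the
    terms of the differentiated series at [x] by those of the series at [K]. *)
Lemma ps_domain_diffs (R : realType) (f : nat -> R) (x K : R) :
  (forall n, 0 <= f n) -> 0 < x -> x < K -> ps_domain f K ->
  ps_domain (pseries_diffs f) x.
Proof.
move=> f0 x0 xK fK.
have K0 : 0 < K by exact: lt_trans xK.
pose d := K / x - 1; have d0 : 0 < d by rewrite subr_gt0 ltr_pdivlMr ?mul1r.
have bern n : n%:R * d <= (K / x) ^+ n.
  have -> : K / x = 1 + d by rewrite /d; ring.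
  elim: n => [|n IH]; first by rewrite mul0r expr0.
  rewrite exprS mulrDl mul1r -natr1 mulrDl mul1r lerD //.
  by rewrite -[leLHS]mulr1 (ler_wpM2l (ltW d0)) // exprn_ege1 // lerDl ltW.
apply: (@series_le_cvg _ _ (fun n => (d * x)^-1 * (f n.+1 * K ^+ n.+1))).
- by move=> n; rewrite /pseries_diffs !mulr_ge0 ?exprn_ge0 // ltW.
- by move=> n; rewrite !mulr_ge0 ?invr_ge0 ?mulr_ge0 ?exprn_ge0 // ltW.
- move=> n; rewrite /pseries_diffs [leRHS]mulrC ler_pdivlMr ?mulr_gt0 //.
  rewrite /= [leLHS](_ : _ = f n.+1 * ((n.+1%:R * d) * x ^+ n.+1)); last first.
    by rewrite exprS; ring.
  rewrite ler_wpM2l // (le_trans (ler_wpM2r _ (bern n.+1))) ?exprn_ge0 ?(ltW x0) //.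
  by rewrite expr_div_n divfK // expf_neq0 // gt_eqF.
have -> : (fun n => (d * x)^-1 * (f n.+1 * K ^+ n.+1)) =
    (d * x)^-1 *: (fun n => f n.+1 * K ^+ n.+1) by [].
apply: is_cvg_seriesZ.
have h : pseries f K n.+1 @[n --> \oo] --> ps_eval f K.
  by rewrite (cvg_shiftS (pseries f K)); exact: cvg_ps_eval.
rewrite (_ : series _ = fun n => pseries f K n.+1 - f 0%N); last first.
  apply/funext => n; rewrite /pseries /series /= big_nat_recl //= expr0 mulr1.
  by rewrite addrC addKr.
by apply/cvg_ex; exists (ps_eval f K - f 0%N); apply: cvgB h (cvg_cst _).
Qed.

Lemma iter_pseries_diffs_ge0 (R : realType) (f : nat -> R) (m n : nat) :
  (forall n, 0 <= f n) -> 0 <= iter m (@pseries_diffs R) f n.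
Proof.
by move=> f0; elim: m n => [//|m IH] n; rewrite iterS /pseries_diffs mulr_ge0.
Qed.

Lemma ps_domain_iter_diffs (R : realType) (f : nat -> R) (m : nat) (x K : R) :
  (forall n, 0 <= f n) -> 0 < x -> x < K -> ps_domain f K ->
  ps_domain (iter m (@pseries_diffs R) f) x.
Proof.
move=> f0; elim: m x => [|m IH] x x0 xK fK.
  by apply: ps_domain_le fK; exact: ltW.
have xy : x < (x + K) / 2 by lra.
rewrite iterS; apply: (@ps_domain_diffs _ _ _ ((x + K) / 2)) => //.
  by move=> n; exact: iter_pseries_diffs_ge0.
by apply: IH => //; lra.
Qed.

Lemma is_derive_ps_eval (R : realType) (f : nat -> R) (x K : R) :
  (forall n, 0 <= f n) -> 0 < x -> x < K -> ps_domain f K ->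
  is_derive x 1 (ps_eval f) (ps_eval (pseries_diffs f) x).
Proof.
move=> f0 x0 xK fK; have xy : x < (x + K) / 2 by lra.
have d m := @ps_domain_iter_diffs R f m ((x + K) / 2) K f0.
have y0 : 0 < (x + K) / 2 by lra.
have yK : (x + K) / 2 < K by lra.
apply: (@pseries_snd_diffs _ f ((x + K) / 2) x).
- exact: (d 0%N).
- exact: (d 1%N).
- exact: (d 2%N).
- by rewrite !gtr0_norm.
Qed.

Lemma interior_right (R : realType) (I : set R) (x : R) :
  interior I x -> exists2 K, x < K & I K.
Proof.
move=> /nbhs_ballP[e /= e0 eI]; exists (x + e / 2); first by rewrite ltrDl divr_gt0.
apply: eI; rewrite /ball /= opprD addrA subrr add0r normrN gtr0_norm ?divr_gt0 //.
by rewrite gtr_pMr // invf_lt1 // ltr1n.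
Qed.

(** Interior points of [I] have a larger point of [I] to their right, so they lie
    strictly inside the disc of convergence, where the series may be
    differentiated term by term any number of times. *)
Lemma absolutely_monotonic_ps (R : realType) (p : nat -> R) (I : set R) (phi : R -> R) :
  (forall n, 0 <= p n) -> I `<=` `]0, +oo[ ->
  (forall x, I x -> ps_domain p x /\ phi x = ps_eval p x) ->
  absolutely_monotonic I phi.
Proof.
move=> p0 I0 pI.
have pos x : I x -> 0 < x by move/I0; rewrite /= in_itv /= andbT.
split=> [x Ix|].
  by have [px ->] := pI x Ix; apply: ps_eval_ge0 => //; exact/ltW/pos.
pose q n := iter n (@pseries_diffs R) p.
have dq n x : interior I x -> is_derive x 1 (ps_eval (q n)) (ps_eval (q n.+1) x).
  move=> Ix; have x0 := pos x (interior_subset Ix).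
  have [K xK IK] := interior_right Ix; have [pK _] := pI K IK.
  have xy : x < (x + K) / 2 by lra.
  apply: (@is_derive_ps_eval _ _ _ ((x + K) / 2)) => //.
    by move=> k; exact: iter_pseries_diffs_ge0.
  by apply: (@ps_domain_iter_diffs R p n _ K) => //; lra.
(* [phi] is given by the series only on [I], but derivatives are local and the
   interior is open. *)
have E n x : interior I x -> derive1n n phi x = ps_eval (q n) x.
  elim: n x => [|n IH] x Ix; first by have [] := pI x (interior_subset Ix).
  rewrite derive1nS derive1E (@near_eq_derive _ _ _ _ (ps_eval (q n))).
    by have [_ ->] := dq n x Ix.
  by have := nbhs_interior Ix; apply: filterS => z; exact: IH.
move=> n x Ix; split.
  apply: (@near_eq_derivable _ _ _ (ps_eval (q n))).
    by have := nbhs_interior Ix; apply: filterS => z Iz; rewrite E.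
  by have [] := dq n x Ix.
rewrite E //; apply: ps_eval_ge0.
- by move=> k; exact: iter_pseries_diffs_ge0.
- by apply/ltW/pos; exact: interior_subset Ix.
have [K xK IK] := interior_right Ix; have [pK _] := pI K IK.
by apply: (@ps_domain_iter_diffs R p n _ K) => //; apply: pos; exact: interior_subset Ix.
Qed.

(** Convexity of the exponential, from its tangent at [m], the logarithm of the
    left-hand side. *)
Lemma powR_young (R : realType) (u v l : R) : 0 < u -> 0 < v -> 0 <= l <= 1 ->
  u `^ l * v `^ (1 - l) <= l * u + (1 - l) * v.
Proof.
move=> u0 v0 /andP[l0 l1].
have tangent (m t : R) : expR m * (1 + (t - m)) <= expR t.
  rewrite -[X in _ <= expR X](subrK m) expRD mulrC ler_pM2r ?expR_gt0 //.
  exact: expR_ge1Dx.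
rewrite /powR !gt_eqF // -expRD; set m := _ + _.
rewrite -(lnK (_ : u \is Num.pos)) ?posrE // -(lnK (_ : v \is Num.pos)) ?posrE //.
have h1 := ler_wpM2l l0 (tangent m (ln u)).
have h2 : (1 - l) * (expR m * (1 + (ln v - m))) <= (1 - l) * expR (ln v).
  by apply: ler_wpM2l; [rewrite subr_ge0|exact: tangent].
apply: le_trans (lerD h1 h2).
by rewrite le_eqVlt; apply/orP; left; apply/eqP; rewrite /m; ring.
Qed.

(** Hoelder's inequality for the series: normalize both series to sum 1, apply
    [powR_young] to each term, and add up. If one of the sums is 0 then every
    coefficient is, and so is the left-hand side. *)
Lemma multiplicatively_convex_ps (R : realType) (p : nat -> R) (I : set R)
    (phi : R -> R) :
  (forall n, 0 <= p n) -> I `<=` `]0, +oo[ ->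
  (forall x z, I x -> 0 < z -> z <= x -> I z) ->
  (forall x, I x -> ps_domain p x /\ phi x = ps_eval p x) ->
  multiplicatively_convex I phi.
Proof.
move=> p0 I0 Idown pI.
have pos x : I x -> 0 < x by move/I0; rewrite /= in_itv /= andbT.
split=> [x Ix|x y l Ix Iy l01].
  by have [px ->] := pI x Ix; apply: ps_eval_ge0 => //; exact/ltW/pos.
have x0 := pos x Ix; have y0 := pos y Iy.
pose z := x `^ l * y `^ (1 - l); rewrite -/z.
have z0 : 0 < z by rewrite mulr_gt0 ?powR_gt0.
have Iz : I z.
  have zle : z <= l * x + (1 - l) * y by exact: powR_young.
  have [xy|/ltW yx] := leP x y.
    by apply: (Idown y) => //; nra.
  by apply: (Idown x) => //; nra.
have [px ->] := pI x Ix; have [py ->] := pI y Iy; have [pz ->] := pI z Iz.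
have vanish w : I w -> ps_domain p w -> ps_eval p w = 0 -> ps_eval p z = 0.
  move=> Iw pw E; have w0 := pos w Iw.
  have pn n : p n = 0.
    have := pseries_le_ps_eval n.+1 p0 (ltW w0) pw.
    rewrite E pseriesE big_ord_recr /= => h.
    have h' : p n * w ^+ n <= 0.
      apply: le_trans h; rewrite lerDr; apply: sumr_ge0 => i _.
      by rewrite mulr_ge0 ?exprn_ge0 // ltW.
    by apply/eqP; rewrite eq_le p0 andbT; move: h'; rewrite pmulr_lle0 // exprn_gt0.
  rewrite /ps_eval (_ : pseries p z = fun=> 0) ?lim_cst //.
  by apply/funext => n; rewrite pseriesE big1 // => i _; rewrite pn mul0r.
set A := ps_eval p x; set B := ps_eval p y.
have A0 : 0 <= A by apply: ps_eval_ge0 => //; exact: ltW.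
have B0 : 0 <= B by apply: ps_eval_ge0 => //; exact: ltW.
have [AE|An0] := eqVneq A 0; first by rewrite (vanish x) // mulr_ge0 ?powR_ge0.
have [BE|Bn0] := eqVneq B 0; first by rewrite (vanish y) // mulr_ge0 ?powR_ge0.
have Ap : 0 < A by rewrite lt_neqAle eq_sym An0.
have Bp : 0 < B by rewrite lt_neqAle eq_sym Bn0.
have limA : pseries p x @ \oo --> A by exact: cvg_ps_eval.
have limB : pseries p y @ \oo --> B by exact: cvg_ps_eval.
clearbody A B; set M := _ * _.
have M0 : 0 < M by rewrite mulr_gt0 ?powR_gt0.
have term n : z ^+ n <= M * (l * (x ^+ n / A) + (1 - l) * (y ^+ n / B)).
  rewrite -ler_pdivrMl //.
  have Ax : 0 < x ^+ n / A by rewrite divr_gt0 ?exprn_gt0.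
  have By : 0 < y ^+ n / B by rewrite divr_gt0 ?exprn_gt0.
  apply: le_trans (powR_young Ax By l01).
  have powRX (w s : R) : 0 < w -> (w ^+ n) `^ s = (w `^ s) ^+ n.
    by move=> w0; rewrite -powR_mulrn ?(ltW w0) // powRAC powR_mulrn ?powR_ge0.
  have powRV (w s : R) : 0 < w -> w^-1 `^ s = (w `^ s)^-1.
    by move=> w0; rewrite -powR_inv1 ?(ltW w0) // powRAC powR_inv1 ?powR_ge0.
  rewrite !powRM ?invr_ge0 ?exprn_ge0 ?(ltW x0) ?(ltW y0) //.
  rewrite !powRX // !powRV // /z /M exprMn invfM.
  by rewrite le_eqVlt; apply/orP; left; apply/eqP; ring.
have lim : M * (l / A * pseries p x n + (1 - l) / B * pseries p y n) @[n --> \oo]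
    --> M * (l / A * A + (1 - l) / B * B).
  by apply: cvgMr; apply: cvgD; apply: cvgMr.
have ME : M * (l / A * A + (1 - l) / B * B) = M.
  by rewrite !divfK // addrC subrK mulr1.
rewrite ME in lim.
rewrite -(cvg_lim _ lim) //; apply: ler_lim => //; first exact: cvgP lim.
apply: nearW => n; rewrite !pseriesE !mulr_sumr -big_split /= mulr_sumr.
apply: ler_sum => i _.
rewrite [leRHS](_ : _ =
  p i * (M * (l * (x ^+ i / A) + (1 - l) * (y ^+ i / B)))); last by ring.
by rewrite ler_wpM2l.
Qed.

(** * Ratios of Gamma functions *)

Definition gamma_ratio (R : realType) (a c t : R) : R :=
  Gamma (a + t) / Gamma (c + t).

(** Dividing the inequality by its right-hand side and regrouping the values of
    [Gamma], it says that the cross ratio of [Gamma] at [a + t] is at most the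
    one at [c + t]. *)
Lemma gamma_ratio_wright (R : realType) (a c : R) : 0 < a -> a <= c ->
  wright_log_convex (gamma_ratio a c).
Proof.
move=> a0 ac; have c0 : 0 < c by exact: lt_le_trans ac.
have posa (t : R) : 0 <= t -> 0 < Gamma (a + t).
  by move=> t0; apply: Gamma_gt0; rewrite ltr_pwDl.
have posc (t : R) : 0 <= t -> 0 < Gamma (c + t).
  by move=> t0; apply: Gamma_gt0; rewrite ltr_pwDl.
split=> [t t0|t p q t0 p0 q0].
  by rewrite /gamma_ratio; apply: divr_ge0; apply: ltW; [exact: posa|exact: posc].
have at0 : 0 < a + t by rewrite ltr_pwDl.
have act : a + t <= c + t by rewrite lerD2r.
have := cross_ratio_nondecreasing (@Gamma_gt0 R) (@GammaD1 R) (@Gamma_wright R)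
  p0 q0 at0 act.
rewrite /cross_ratio /gamma_ratio -!addrA.
have tp := addr_ge0 t0 p0; have tq := addr_ge0 t0 q0.
have tpq := addr_ge0 t0 (addr_ge0 p0 q0).
move: (posa _ t0) (posa _ tp) (posa _ tq) (posa _ tpq).
move: (posc _ t0) (posc _ tp) (posc _ tq) (posc _ tpq).
move: (Gamma (a + t)) (Gamma (a + (t + p))) (Gamma (a + (t + q)))
  (Gamma (a + (t + (p + q)))) => A Ap Aq Apq.
move: (Gamma (c + t)) (Gamma (c + (t + p))) (Gamma (c + (t + q)))
  (Gamma (c + (t + (p + q)))) => C Cp Cq Cpq.
move=> C0 Cp0 Cq0 Cpq0 A0 Ap0 Aq0 Apq0 h.
have k0 : 0 <= A * Apq / (Cp * Cq) by rewrite divr_ge0 // mulr_ge0 // ltW.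
have := ler_wpM2l k0 h; congr (is_true (_ <= _)).
  by field; rewrite !gt_eqF.
by field; rewrite !gt_eqF.
Qed.

Lemma continuous_gamma_ratio (R : realType) (a c t : R) : 0 < a + t -> 0 < c + t ->
  {for t, continuous (gamma_ratio a c)}.
Proof.
move=> at0 ct0.
have shift (b : R) : 0 < b + t -> Gamma (b + u) @[u --> t] --> Gamma (b + t).
  move=> bt0; apply: (@cvg_comp _ _ _ (fun u => b + u) (@Gamma R)).
    by apply: cvgD; [exact: cvg_cst|exact: cvg_id].
  exact: continuous_Gamma.
apply: cvgM; first exact: shift.
apply: cvgV; first by rewrite gt_eqF // Gamma_gt0.
exact: shift.
Qed.

Lemma g_coefE (R : realType) (g : nat -> R) (a c mu : R) :
  g_coef g a c mu = fun k => g k / k`!%:R * gamma_ratio a c (k%:R + mu).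
Proof.
apply/funext => k; rewrite /g_coef /gamma_ratio -!addrA.
by rewrite mulrAC.
Qed.

Unset Implicit Arguments.

Theorem theorem3 (R : realType) (a c : R) (g : nat -> R)
    (ha : 0 < a) (hac : a <= c) (hg : forall n, 0 <= g n) :
  [/\ forall x : R, 0 <= x ->
        (forall mu : R, 0 <= mu -> ps_domain (g_coef g a c mu) x) ->
        wright_log_convex (fun mu => g_fun g a c mu x),
      wright_q_log_convex (g_coef g a c) &
      forall mu nu : R, 0 <= mu -> 0 <= nu ->
        [/\ forall n, psi_coef g a c mu nu n <= 0,
            absolutely_monotonic (psi_domain g a c mu nu)
              (fun x => - psi_fun g a c mu nu x) &
            multiplicatively_convex (psi_domain g a c mu nu)
              (fun x => - psi_fun g a c mu nu x)]].
Proof.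
have hc : 0 < c by exact: lt_le_trans hac.
have FW := gamma_ratio_wright ha hac.
have v0 k : 0 <= g k / k`!%:R by rewrite divr_ge0.
have coef_ge0 mu n : 0 <= mu -> 0 <= g_coef g a c mu n.
  move=> mu0; rewrite g_coefE; apply: mulr_ge0 => //.
  by apply: FW.1; rewrite addr_ge0.
have cauchy_le mu p q n : 0 <= mu -> 0 <= p -> 0 <= q ->
    cauchy_prod (g_coef g a c (mu + p)) (g_coef g a c (mu + q)) n <=
    cauchy_prod (g_coef g a c mu) (g_coef g a c (mu + p + q)) n.
  by move=> mu0 p0 q0; rewrite !g_coefE; exact: cauchy_prod_wright.
have psi_le0 mu nu n : 0 <= mu -> 0 <= nu -> psi_coef g a c mu nu n <= 0.
  move=> mu0 nu0; rewrite /psi_coef subr_le0.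
  by have := cauchy_le 0 mu nu n (lexx _) mu0 nu0; rewrite !add0r.
split.
- move=> x x0 hx; split=> [mu mu0|mu p q mu0 p0 q0].
    by apply: ps_eval_ge0 => [n||]; [exact: coef_ge0| |exact: hx].
  have mp := addr_ge0 mu0 p0; have mq := addr_ge0 mu0 q0; have mpq := addr_ge0 mp q0.
  have l s t (s0 : 0 <= s) (t0 : 0 <= t) :=
    cvg_cauchy_prod (fun n => coef_ge0 s n s0) (fun n => coef_ge0 t n t0) x0
      (hx s s0) (hx t t0).
  apply: ler_cvg_to (l _ _ mp mq) (l _ _ mu0 mpq) _.
  by apply: nearW => n; apply: pseries_le x0 => k; exact: cauchy_le.
- split.
  + by move=> mu n; exact: coef_ge0.
  + move=> n; apply: continuous_in_subspaceT => mu.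
    rewrite inE /= in_itv /= andbT => mu0.
    have nm : 0 <= n%:R + mu by rewrite addr_ge0.
    rewrite (_ : (fun mu => _) =
      fun mu => g n / n`!%:R * gamma_ratio a c (n%:R + mu)); last first.
      by apply/funext => t; rewrite g_coefE.
    apply: cvgMr; apply: (@cvg_comp _ _ _ (fun u => n%:R + u) (gamma_ratio a c)).
      by apply: cvgD; [exact: cvg_cst|exact: cvg_id].
    by apply: continuous_gamma_ratio; rewrite ltr_pwDl.
  + by move=> mu p q mu0 p0 q0 n; rewrite subr_le0 cauchy_le.
move=> mu nu mu0 nu0.
(* Minus psi is the sum of a power series with nonnegative coefficients [p] at
   every point of its domain; the last two claims are facts about such sums. *)
pose p n := - psi_coef g a c mu nu n.
have pE : p = fun n => cauchy_prod (g_coef g a c 0) (g_coef g a c (mu + nu)) n -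
    cauchy_prod (g_coef g a c mu) (g_coef g a c nu) n.
  by apply/funext => n; exact: opprB.
have p0 n : 0 <= p n by rewrite oppr_ge0 psi_le0.
have I0 : psi_domain g a c mu nu `<=` `]0, +oo[ by move=> x [].
have pI x : psi_domain g a c mu nu x ->
    ps_domain p x /\ - psi_fun g a c mu nu x = ps_eval p x.
  move=> [x_gt0 [[[h1 h2] h3] h4]].
  have x0 : 0 <= x by move: x_gt0; rewrite /= in_itv /= andbT => /ltW.
  have mn := addr_ge0 mu0 nu0.
  have l1 := cvg_cauchy_prod (fun n => coef_ge0 mu n mu0)
    (fun n => coef_ge0 nu n nu0) x0 h1 h2.
  have l2 := cvg_cauchy_prod (fun n => coef_ge0 0 n (lexx _))
    (fun n => coef_ge0 _ n mn) x0 h3 h4.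
  have l : pseries p x n @[n --> \oo] --> - psi_fun g a c mu nu x.
    rewrite (_ : pseries p x = fun n =>
        pseries (cauchy_prod (g_coef g a c 0) (g_coef g a c (mu + nu))) x n -
        pseries (cauchy_prod (g_coef g a c mu) (g_coef g a c nu)) x n).
      by rewrite /psi_fun opprB; apply: cvgB l2 l1.
    by apply/funext => n; rewrite pE pseriesB.
  by split; [exact: cvgP l|rewrite /ps_eval (cvg_lim _ l)].
split.
- by move=> n; exact: psi_le0.
- exact: absolutely_monotonic_ps p0 I0 pI.
- apply: multiplicatively_convex_ps p0 I0 _ pI => x z [_ [[[h1 h2] h3] h4]] z0 zx.
  have d u := ps_domain_le (f := u) (ltW z0) zx.
  by split; [rewrite /= in_itv /= z0|split; [split; [split|]|]; exact: d].
Qed.
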